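(* Let $\rho:\mathcal{X}\times\mathcal{Z}\to\mathbb{R}$ be a rating function with sensitivity $\Delta$, where $|\mathcal{Z}|\in\mathbb{N}$. Take any fixed $x\in\mathcal{X}$ and denote by $\hat\rho_x$ and $\check\rho_x$ the maximum and minimum rating scores $\rho(x,z)$ of any output $z\in\mathcal{Z}$ for $x$, respectively. For a desired minimum rating $\tau\in[\check\rho_x,\hat\rho_x]$, split $\mathcal{Z}$ into $\mathcal{T}:=\{z\in\mathcal{Z}:\rho(x,z)\ge\tau\}$ and $\overline{\mathcal{T}}:=\mathcal{Z}\setminus\mathcal{T}$. Let $c:=\tau-\max_{z\in\overline{\mathcal{T}}}\rho(x,z)$ be the difference between $\tau$ and the next lower rating score, and let $\bar\Delta:=\hat\rho_x-\check\rho_x$. Given a probability $p\in[0,1]$, we have the following necessary and sufficient conditions on $\epsilon$ for $\Pr[\mathcal{E}_{\epsilon,\rho}(x)\in\mathcal{T}]\ge p$, where $\mathcal{E}_{\epsilon,\rho}$ is the Exponential mechanism: $$\epsilon\ge\begin{cases}\dfrac{2\Delta}{\bar\Delta}\ln\left(\dfrac{p}{1-p}\cdot\dfrac{|\overline{\mathcal{T}}|}{|\mathcal{T}|}\right) & \text{(necessary condition)}\\[2ex] \dfrac{2\Delta}{c}\ln\left(\dfrac{p}{1-p}\cdot\dfrac{|\overline{\mathcal{T}}|}{|\mathcal{T}|}\right) & \text{(sufficient condition)}\end{cases}$$ That is, the first inequality is necessary for $\Pr[\mathcal{E}_{\epsilon,\rho}(x)\in\mathcal{T}]\ge p$, and the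 second inequality is sufficient for it.
   Context: **Adjacency and sensitivity.** $\mathcal{X}$ carries a metric $d_{\mathcal{X}}$; inputs $x_1,x_2\in\mathcal{X}$ are adjacent, written $x_1\sim x_2$, if $d_{\mathcal{X}}(x_1,x_2)\le1$. A rating function from $\mathcal{X}$ to $\mathcal{Z}$ is a function $\rho:\mathcal{X}\times\mathcal{Z}\to\mathbb{R}$, and its sensitivity is $\Delta=\max_{z\in\mathcal{Z}}\max_{x_1\sim x_2}\big(\rho(x_1,z)-\rho(x_2,z)\big)$. **Exponential mechanism (discrete version).** For a privacy parameter $\epsilon>0$ and $x\in\mathcal{X}$, $\mathcal{E}_{\epsilon,\rho}(x)$ is the $\mathcal{Z}$-valued random variable with $$\Pr[\mathcal{E}_{\epsilon,\rho}(x)=z]=\frac{\exp\left(\frac{\epsilon}{2\Delta}\rho(x,z)\right)}{\sum_{z'\in\mathcal{Z}}\exp\left(\frac{\epsilon}{2\Delta}\rho(x,z')\right)}.$$ *)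

(* Defs.v *)
From HB Require Import structures.
From mathcomp Require Import all_boot all_order all_algebra.
From mathcomp Require Import all_classical all_reals all_analysis.

Set Implicit Arguments.
Unset Strict Implicit.
Unset Printing Implicit Defensive.

Import Order.TTheory GRing.Theory Num.Theory.

Local Open Scope classical_set_scope.
Local Open Scope ring_scope.

Definition adjacent (R : realType) (X : metricType R) (x1 x2 : X) : Prop :=
  mdist x1 x2 <= 1.

Definition score_changes (R : realType) (X : metricType R) (Z : finType)
    (rho : X -> Z -> R) : set R :=
  [set r | exists z x1 x2, adjacent x1 x2 /\ r = rho x1 z - rho x2 z].

Definition is_sensitivity (R : realType) (X : metricType R) (Z : finType)
    (rho : X -> Z -> R) (Delta : R) : Prop :=
  score_changes rho Delta /\ ubound (score_changes rho) Delta.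

Definition exp_mech_pmf (R : realType) (X : metricType R) (Z : finType)
    (rho : X -> Z -> R) (Delta eps : R) (x : X) (z : Z) : R :=
  expR (eps / (2 * Delta) * rho x z) /
    \sum_(z' : Z) expR (eps / (2 * Delta) * rho x z').

(* The finite set Z carries the discrete sigma-algebra. *)
Definition is_exp_mech (R : realType) (X : metricType R) (Z : finType)
    (rho : X -> Z -> R) (Delta eps : R) (x : X)
    (d : measure_display) (Omega : measurableType d) (P : probability Omega R)
    (E : Omega -> Z) : Prop :=
  (forall A : set Z, measurable (E @^-1` A)) /\
  (forall z : Z, P (E @^-1` [set z]) = (exp_mech_pmf rho Delta eps x z)%:E).

(* Extended reals, so that the maximum over the empty set is -oo (and the
   minimum +oo); on a nonempty A these are the usual maximum and minimum. *)
Definition max_score (R : realType) (X : metricType R) (Z : finType)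
    (rho : X -> Z -> R) (x : X) (A : {set Z}) : \bar R :=
  \big[maxe/-oo%E]_(z in A) (rho x z)%:E.

Definition min_score (R : realType) (X : metricType R) (Z : finType)
    (rho : X -> Z -> R) (x : X) (A : {set Z}) : \bar R :=
  \big[mine/+oo%E]_(z in A) (rho x z)%:E.

(* (2 Delta / w) ln ((p / (1 - p)) (m / n)), computed in the extended reals so
   that it also makes sense for p = 0, p = 1 and m = 0. Library conventions:
   0^-1 = +oo, +oo^-1 = 0, 0 * (+oo) = 0 * (-oo) = 0, lne 0 = -oo,
   lne +oo = +oo. *)
Definition eps_bound (R : realType) (Delta p : R) (m n : nat) (w : \bar R)
    : \bar R :=
  ((2 * Delta)%:E / w *
    lne (p%:E / (1 - p)%:E * (m%:R%:E / n%:R%:E)))%E.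

(* Main.v *)
(* With [k = eps / (2 Delta)], the event [T] has probability at least [p] iff
   [p * S(Tbar) <= (1 - p) * S(T)], where [S(A)] sums [exp (k rho(x, z))] over
   [z] in [A]. Necessity bounds [S(Tbar)] below using the minimal score and
   [S(T)] above using the maximal one; sufficiency bounds [S(Tbar)] above using
   [tau - c] and [S(T)] below using [tau]. Taking logarithms of
   [p |Tbar| <= (1 - p) |T| exp (k w)] gives the bounds on [eps], with
   [w = Deltabar] and [w = c] respectively. *)
Require Import Defs.
From HB Require Import structures.
From mathcomp Require Import all_boot all_order all_algebra.
From mathcomp Require Import all_classical all_reals all_analysis.
From mathcomp Require Import ring lra.

Set Implicit Arguments.
Unset Strict Implicit.
Unset Printing Implicit Defensive.

Import Order.TTheory GRing.Theory Num.Theory.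

Local Open Scope classical_set_scope.
Local Open Scope ring_scope.

Lemma max_score_attained (R : realType) (X : metricType R) (Z : finType)
    (rho : X -> Z -> R) (x : X) (A : {set Z}) (z0 : Z) : z0 \in A ->
  exists z, [/\ z \in A, max_score rho x A = (rho x z)%:E &
    forall z', z' \in A -> rho x z' <= rho x z].
Proof.
move=> z0A; rewrite /max_score (bigmax_eq_arg _ _ _ _ z0A);
  last by move=> i _; rewrite leNye.
case: arg_maxP => // z zA zmax; by exists z.
Qed.

Lemma min_score_attained (R : realType) (X : metricType R) (Z : finType)
    (rho : X -> Z -> R) (x : X) (A : {set Z}) (z0 : Z) : z0 \in A ->
  exists z, [/\ z \in A, min_score rho x A = (rho x z)%:E &
    forall z', z' \in A -> rho x z <= rho x z'].
Proof.
move=> z0A; rewrite /min_score (bigmin_eq_arg _ _ _ _ z0A);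
  last by move=> i _; rewrite leey.
case: arg_minP => // z zA zmin; by exists z.
Qed.

(** The event is the finite disjoint union of the fibres of [E] over [A], so additivity reduces it
    to the point masses. *)
Lemma exp_mech_prob (R : realType) (X : metricType R) (Z : finType)
    (rho : X -> Z -> R) (Delta eps : R) (x : X)
    (d : measure_display) (Omega : measurableType d) (P : probability Omega R)
    (E : Omega -> Z) (A : {set Z}) : is_exp_mech rho Delta eps x P E ->
  P [set w | E w \in A] =
    (\sum_(z in A) exp_mech_pmf rho Delta eps x z)%:E.
Proof.
move=> [mE PE].
have -> : [set w | E w \in A] =
    \bigcup_(z in [set` A]) (E @^-1` [set z]).
  by apply/seteqP; split => [w /= wA|w [z /= zA /= ->]//]; exists (E w).
rewrite measure_fin_bigcup //=.
- rewrite -(@bigfs _ _ _ _ (index_enum Z)) ?index_enum_uniq//; last first.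
    by move=> i _; rewrite mem_index_enum.
  by rewrite -sumEFin; apply: eq_bigr.
- by apply/trivIsetP => i j _ _ ij; apply/seteqP; split => [w [/= -> /eqP]|//];
    rewrite (negbTE ij).
Qed.

(** Multiply by the normalising sum, split that sum over [A] and its complement, and cancel. The
    point [z0] makes the sum positive. *)
Lemma exp_mech_ge (R : realType) (X : metricType R) (Z : finType)
    (rho : X -> Z -> R) (Delta eps p : R) (x : X) (A : {set Z}) (z0 : Z) :
  (p <= \sum_(z in A) exp_mech_pmf rho Delta eps x z) =
  (p * \sum_(z in ~: A) expR (eps / (2 * Delta) * rho x z) <=
   (1 - p) * \sum_(z in A) expR (eps / (2 * Delta) * rho x z)).
Proof.
rewrite /exp_mech_pmf -mulr_suml.
set f := fun z => expR (eps / (2 * Delta) * rho x z).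
have fpos : 0 < \sum_z f z.
  rewrite (bigD1 z0)//= ltr_pwDl ?expR_gt0//.
  by apply: sumr_ge0 => i _; exact: expR_ge0.
have fE : \sum_z f z = \sum_(z in A) f z + \sum_(z in ~: A) f z.
  rewrite (bigID (mem A))/=; congr (_ + _).
  by apply: eq_bigl => z; rewrite inE.
by rewrite ler_pdivlMr// fE; apply/idP/idP => ?; lra.
Qed.

(** Both bounds of the theorem pass through this equivalence, with [W] the rating gap. For
    [0 < p < 1] it is monotonicity of [expR]; the endpoints are handled by the extended-real
    conventions. *)
Lemma eps_bound_le (R : realType) (Delta p eps W : R) (m n : nat) :
  0 < Delta -> 0 <= p <= 1 -> 0 < W -> (0 < m)%N -> (0 < n)%N ->
  (eps_bound Delta p m n W%:E <= eps%:E)%E =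
  (p * m%:R <= (1 - p) * (n%:R * expR (eps / (2 * Delta) * W))).
Proof.
move=> D0 /andP[p0 p1] W0 m0 n0.
have mR : 0 < m%:R :> R by rewrite ltr0n.
have nR : 0 < n%:R :> R by rewrite ltr0n.
have eR := expR_gt0 (eps / (2 * Delta) * W).
have DW : 0 < 2 * Delta / W by rewrite divr_gt0// mulr_gt0.
rewrite /eps_bound !inver (gt_eqF W0) (gt_eqF nR) -!EFinM.
(* Here the bound is [+oo] and the right-hand side is [0 < m]: both sides are false. *)
have [->|pn1] := eqVneq p 1.
  rewrite subrr eqxx mul1e gt0_mulye ?lte_fin ?divr_gt0// mul0r mul1r.
  by rewrite gt0_muley ?lte_fin// leye_eq/= leNgt mR.
have q0 : 0 < 1 - p by rewrite subr_gt0 lt_neqAle pn1.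
rewrite gt_eqF// -!EFinM.
(* Here the logarithm is [-oo], and both sides are true. *)
have [->|pn0] := eqVneq p 0.
  by rewrite !mul0r le0_lneNy// gt0_muleNy ?lte_fin// leNye subr0 mul1r
    mulr_ge0// ltW.
have p_gt0 : 0 < p by rewrite lt_neqAle eq_sym pn0.
have r_gt0 : 0 < p / (1 - p) * (m%:R / n%:R) by rewrite !(mulr_gt0, invr_gt0).
rewrite lne_EFin// -EFinM lee_fin -ler_pdivlMl// -[LHS]ler_expR lnK ?posrE//.
have -> : (2 * Delta / W)^-1 * eps = eps / (2 * Delta) * W.
  by field; rewrite !gt_eqF.
have -> : p / (1 - p) * (m%:R / n%:R) = p * m%:R / ((1 - p) * n%:R).
  by field; rewrite !gt_eqF.
by rewrite ler_pdivrMr ?mulr_gt0// [leRHS]mulrC mulrA.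
Qed.

(** This serves the case of an empty [Tbar]. There all scores may coincide, so [W = 0] is allowed;
    the prefactor is then [+oo], still positive. *)
Lemma eps_bound_0 (R : realType) (Delta p W : R) (n : nat) :
  0 < Delta -> 0 <= W -> eps_bound Delta p 0 n W%:E = -oo%E.
Proof.
move=> D0 W0; rewrite /eps_bound mul0e mule0 le0_lneNy// gt0_muleNy//.
rewrite inver; case: eqVneq => [_|Wn0].
  by rewrite gt0_muley ?lte_fin ?mulr_gt0// lt0y.
by rewrite -EFinM lte_fin divr_gt0 ?mulr_gt0// lt_neqAle eq_sym Wn0.
Qed.

Lemma sum_expR_ge (R : realType) (Z : finType) (A : {set Z}) (f : Z -> R)
    (k b : R) : 0 <= k -> (forall z, z \in A -> b <= f z) ->
  #|A|%:R * expR (k * b) <= \sum_(z in A) expR (k * f z).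
Proof.
move=> k0 bf; rewrite mulr_natl -sumr_const; apply: ler_sum => z zA.
by rewrite ler_expR ler_wpM2l// bf.
Qed.

Lemma sum_expR_le (R : realType) (Z : finType) (A : {set Z}) (f : Z -> R)
    (k b : R) : 0 <= k -> (forall z, z \in A -> f z <= b) ->
  \sum_(z in A) expR (k * f z) <= #|A|%:R * expR (k * b).
Proof.
move=> k0 bf; rewrite mulr_natl -sumr_const; apply: ler_sum => z zA.
by rewrite ler_expR ler_wpM2l// bf.
Qed.

Theorem corollary3p7 (R : realType) (X : metricType R) (Z : finType)
    (rho : X -> Z -> R) (Delta : R)
    (hDelta : is_sensitivity rho Delta) (Delta_gt0 : 0 < Delta)
    (x : X) (tau : R)
    (htau : (min_score rho x [set: Z] <= tau%:E <= max_score rho x [set: Z])%E)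
    (p : R) (hp : 0 <= p <= 1)
    (eps : R) (eps_gt0 : 0 < eps)
    (d : measure_display) (Omega : measurableType d) (P : probability Omega R)
    (E : Omega -> Z) (hE : is_exp_mech rho Delta eps x P E) :
  let T : {set Z} := [set z | tau <= rho x z]%SET in
  let Tbar : {set Z} := (~: T)%SET in
  let c : \bar R := (tau%:E - max_score rho x Tbar)%E in
  let Deltabar : \bar R :=
    (max_score rho x [set: Z] - min_score rho x [set: Z])%E in
  let PrT : \bar R := P [set w | E w \in T] in
  ((p%:E <= PrT)%E ->
     (eps_bound Delta p #|Tbar| #|T| Deltabar <= eps%:E)%E) /\
  ((eps_bound Delta p #|Tbar| #|T| c <= eps%:E)%E ->
     (p%:E <= PrT)%E).
Proof.
move=> T Tbar c Deltabar PrT.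
(* On an empty [Z] the minimum would be [+oo], which cannot lie below [tau]. *)
have [z0 _] : exists z : Z, true.
  case: (pickP (fun _ : Z => true)) => [z _|Z0]; first by exists z.
  move: htau; rewrite /min_score /max_score !big1 ?leye_eq// => z;
    by have := Z0 z.
have [zM [_ maxE zMmax]] := max_score_attained rho x (finset.in_setT z0).
have [zm [_ minE zmmin]] := min_score_attained rho x (finset.in_setT z0).
have /andP[tau_min tau_max] : rho x zm <= tau <= rho x zM.
  by rewrite -!lee_fin -minE -maxE.
have T0 : (0 < #|T|)%N by apply/card_gt0P; exists zM; rewrite inE.
have DE : Deltabar = (rho x zM - rho x zm)%:E.
  by rewrite /Deltabar maxE minE.
set k := eps / (2 * Delta).
have k0 : 0 <= k by rewrite divr_ge0 ?mulr_ge0 ?ltW.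
have /andP[p0 p1] := hp.
have q0 : 0 <= 1 - p by rewrite subr_ge0.
rewrite /PrT (exp_mech_prob T hE) lee_fin (exp_mech_ge _ _ _ _ _ _ z0).
rewrite -/Tbar -/k.
(* If [Tbar] is empty, the necessary bound is [-oo] and the probability inequality holds outright,
   so [c] need not be evaluated. *)
have [Tbar0|[zb zbT]] := set_0Vmem Tbar.
  rewrite Tbar0 cards0 big_set0 mulr0 DE.
  rewrite eps_bound_0 ?leNye ?subr_ge0 ?(le_trans tau_min)//.
  by split=> // _; rewrite mulr_ge0// sumr_ge0// => z _; exact: expR_ge0.
have Tb0 : (0 < #|Tbar|)%N by apply/card_gt0P; exists zb.
have TbarP z : z \in Tbar -> rho x z < tau by rewrite !inE ltNge.
have [zc [zcT cE zcmax]] := max_score_attained rho x zbT.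
split.
(* The element [zb] scores strictly below [tau], hence below the maximum. *)
- have D0 : 0 < rho x zM - rho x zm.
    by rewrite subr_gt0 (le_lt_trans (zmmin zb _) (lt_le_trans (TbarP _ zbT) _)).
  rewrite DE eps_bound_le// -/k => PrTge.
  have := sum_expR_ge k0 (fun z (_ : z \in Tbar) => zmmin z (finset.in_setT z)).
  move=> /(ler_wpM2l p0)/le_trans/(_ PrTge).
  have := sum_expR_le k0 (fun z (_ : z \in T) => zMmax z (finset.in_setT z)).
  move=> /(ler_wpM2l q0) /[swap] /le_trans /[apply].
  (* Dividing by [expR (k * rho x zm)] merges the two exponentials into one of the gap. *)
  by rewrite mulrBr expRD expRN !mulrA ler_pdivlMr ?expR_gt0.
- have c0 : 0 < tau - rho x zc by rewrite subr_gt0 TbarP.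
  rewrite /c cE -EFinB eps_bound_le// -/k => cle.
  have /(ler_wpM2l p0)/le_trans := sum_expR_le k0 zcmax; apply.
  have Tge z : z \in T -> tau <= rho x z by rewrite inE.
  apply: le_trans (ler_wpM2l q0 (sum_expR_ge k0 Tge)).
  by move: cle; rewrite mulrBr expRD expRN !mulrA ler_pdivlMr ?expR_gt0.
Qed.
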